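(* Let $\varphi$ be a polynomial with real coefficients, of degree greater than one, having fixed points in $\mathbb{R}$ (i.e. there is $a\in\mathbb{R}$ with $\varphi(a)=a$). Then $\overline{\mathbb{D}}\setminus\{0\}\subset\sigma(C_\varphi)$.
   Context: $\overline{\mathbb{D}}=\{\lambda\in\mathbb{C}:|\lambda|\le 1\}$. $\mathcal{S}(\mathbb{R})$ is the Fréchet space of (complex-valued) smooth rapidly decreasing functions on $\mathbb{R}$ (Schwartz space). For a non-constant real polynomial $\varphi$, the composition operator $C_\varphi:\mathcal{S}(\mathbb{R})\to\mathcal{S}(\mathbb{R})$, $C_\varphi f=f\circ\varphi$, is well defined, linear and continuous. For a continuous linear operator $T:X\to X$ on a Fréchet space $X$, the spectrum $\sigma(T)$ is the set of all $\lambda\in\mathbb{C}$ such that $T-\lambda I:X\to X$ does not admit a continuous linear inverse. *)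

(* Defs.v *)
From HB Require Import structures.
From mathcomp Require Import all_boot all_order all_algebra.
From mathcomp Require Import complex.
From mathcomp Require Import all_classical all_reals all_analysis.
From mathcomp Require Import ring lra.

Set Implicit Arguments.
Unset Strict Implicit.
Unset Printing Implicit Defensive.

Import Order.TTheory GRing.Theory Num.Theory.
Import numFieldTopology.Exports numFieldNormedType.Exports.
Import Normc.

Local Open Scope ring_scope.
Local Open Scope complex_scope.
Local Open Scope classical_set_scope.

Definition spectrum (K : numFieldType) (X : tvsType K) (T : {linear X -> X}) : set K :=
  [set l | ~ exists S : {linear X -> X}, [/\ continuous S,
      cancel (fun f => T f - l *: f) S & cancel S (fun f => T f - l *: f)]].

Section Derivatives.
Variable R : realType.
Implicit Type f : R -> R[i].

(* R[i] is not a normed module over R in the library, so derivatives with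
   respect to a real variable are taken on the real and imaginary parts. *)
Definition cderive1n (n : nat) f : R -> R[i] :=
  fun x => (derive1n n (@complex.Re R \o f) x +i* derive1n n (@complex.Im R \o f) x).

Definition smooth f := forall n x,
  derivable (derive1n n (@complex.Re R \o f)) x 1 /\ derivable (derive1n n (@complex.Im R \o f)) x 1.

Definition rapidly_decreasing f := forall k n, exists M : R, forall x,
  `|x| ^+ k * normc (cderive1n n f x) <= M.

Definition schwartz_pred : {pred R -> R[i]} :=
  [pred f | `[< smooth f /\ rapidly_decreasing f >]].

End Derivatives.

Arguments schwartz_pred : clear implicits.


Section RealFacts.
Variable R : realType.
Implicit Types u v : R -> R.

Definition rsmooth u := forall n x, derivable ((derive1n n u)) x 1.
Definition rrapid u := forall k n, exists M : R, forall x,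
  `|x| ^+ k * `|(derive1n n u) x| <= M.

Lemma derive1n_lin (a b : R) u v n : rsmooth u -> rsmooth v ->
  derive1n n (fun x => a * u x + b * v x) = (fun x => a * (derive1n n u) x + b * (derive1n n v) x).
Proof.
move=> su sv; elim: n => [//|n IH]; rewrite derive1nS IH; apply/funext => x.
have du := su n x; have dv := sv n x.
rewrite derive1E.
rewrite (_ : (fun _ => _) = (a *: (derive1n n u)) + (b *: (derive1n n v))); last by [].
rewrite deriveD; [|exact: derivableZ|exact: derivableZ].
by rewrite (deriveZ _ du) (deriveZ _ dv) !derive1nS !derive1E.
Qed.

Lemma rsmooth_lin (a b : R) u v : rsmooth u -> rsmooth v ->
  rsmooth (fun x => a * u x + b * v x).
Proof.
move=> su sv n x; rewrite derive1n_lin //.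
rewrite (_ : (fun _ => _) = (a *: (derive1n n u)) + (b *: (derive1n n v))); last by [].
by apply: derivableD; apply: derivableZ.
Qed.

Lemma rrapid_lin (a b : R) u v : rsmooth u -> rsmooth v ->
  rrapid u -> rrapid v -> rrapid (fun x => a * u x + b * v x).
Proof.
move=> su sv ru rv k n; have [M HM] := ru k n; have [N HN] := rv k n.
exists (`|a| * M + `|b| * N) => x; rewrite derive1n_lin //.
apply: (@le_trans _ _ (`|x| ^+ k * (`|a| * `|(derive1n n u) x| + `|b| * `|(derive1n n v) x|))).
  by rewrite ler_wpM2l ?exprn_ge0 // -!normrM ler_normD.
by rewrite mulrDr lerD // mulrCA ler_wpM2l.
Qed.

Section Comp.
Variables (u : R -> R) (phi : {poly R}).
Hypothesis su : rsmooth u.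

Let F (s : seq ({poly R} * nat)) x :=
  \sum_(i <- s) i.1.[x] * (derive1n i.2 u) phi.[x].
Let D (s : seq ({poly R} * nat)) : seq ({poly R} * nat) :=
  flatten [seq [:: (deriv i.1, i.2); (i.1 * deriv phi, i.2.+1)] | i <- s].

Lemma is_derive_F s (x : R) : is_derive x (1 : R) (F s) (F (D s) x).
Proof.
elim: s => [|[p j] s IH].
  rewrite /D /= (_ : F [::] = cst 0); first by rewrite /=; exact: is_derive_cst.
  by apply/funext => y; rewrite /F big_nil.
rewrite (_ : F ((p, j) :: s) = (horner p) * ((derive1n j u) \o horner phi) + F s);
  last by apply/funext => y; rewrite /F big_cons.
have -> : F (D ((p, j) :: s)) x =
   (p.[x] * ((derive1n j.+1 u) phi.[x] * (deriv phi).[x]) + ((derive1n j u) phi.[x]) * (deriv p).[x])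
     + F (D s) x.
  rewrite /F /D /= !big_cons /= hornerM; set S := \sum_(i <- _) _; ring.
apply: is_deriveD.
have H1 : is_derive x (1:R) ((derive1n j u) \o horner phi)
   ((derive1n j.+1 u) phi.[x] * (deriv phi).[x]).
  have dphi : derivable (horner phi) x 1 by exact: derivable_horner.
  have du : derivable ((derive1n j u)) phi.[x] 1 by exact: su.
  apply: DeriveDef.
    have dphi' : differentiable (horner phi) x by exact/derivable1_diffP.
    have du' : differentiable (derive1n j u) (horner phi x).
      by move/derivable1_diffP: du.
    by apply/derivable1_diffP; exact: (differentiable_comp dphi' du').
  by rewrite -derive1E (derive1_comp dphi du) -derivE derive1nS.
have H2 := is_derive_poly p x.
have := @is_deriveM _ _ (horner p) ((derive1n j u) \o horner phi) x 1 _ _ H2 H1.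
by [].
Qed.

Lemma derive1n_comp n : derive1n n (u \o horner phi) = F (iter n D [:: (1, 0%N)]).
Proof.
elim: n => [|n IH].
  by apply/funext => x; rewrite /F big_seq1 /= hornerC mul1r.
rewrite derive1nS IH; apply/funext => x; rewrite derive1E.
by have H := is_derive_F (iter n D [:: (1, 0%N)]) x; rewrite derive_val.
Qed.

Lemma rsmooth_comp : rsmooth (u \o horner phi).
Proof.
move=> n x; rewrite derive1n_comp.
by have H := is_derive_F (iter n D [:: (1, 0%N)]) x; exact: ex_derive.
Qed.

End Comp.

Lemma poly_away0 (p : {poly R}) : p != 0 ->
  exists a M : R, [/\ 0 < a, 0 <= M & forall x, M <= `|x| -> a <= `|p.[x]|].
Proof.
elim/poly_ind: p => [|p c IH]; first by rewrite eqxx.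
have [-> | p0] := eqVneq p 0.
  rewrite mul0r add0r polyC_eq0 => c0; exists `|c|, 0; split => //.
    by rewrite normr_gt0.
  by move=> x _; rewrite hornerC.
move=> _; have [a [M [a0 M0 H]]] := IH p0.
exists 1, (M + (1 + `|c|) / a); split => //.
  by rewrite addr_ge0 // divr_ge0 ?addr_ge0 // ltW.
move=> x xM; rewrite hornerD hornerM hornerX hornerC.
have cc := normr_ge0 c.
have xM1 : M <= `|x|.
  by apply: le_trans xM; rewrite lerDl divr_ge0 ?addr_ge0 // ltW.
have xM2 : (1 + `|c|) / a <= `|x| by apply: le_trans xM; rewrite lerDr.
have : 1 + `|c| <= `|p.[x] * x|.
  rewrite normrM; apply: (@le_trans _ _ (a * `|x|)).
    by rewrite mulrC -ler_pdivrMr.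
  by rewrite ler_wpM2r // H.
by have := lerB_dist (p.[x] * x) (- c); rewrite normrN opprK; lra.
Qed.

Lemma poly_growth (phi : {poly R}) : (1 < size phi)%N ->
  exists2 C : R, 0 <= C & forall x, 1 + `|x| <= C * (1 + `|phi.[x]|).
Proof.
elim/poly_ind: phi => [|p c _]; first by rewrite size_poly0.
rewrite size_MXaddC; case: ifP => // /negbT; rewrite negb_and => H.
rewrite ltnS size_poly_gt0 => p0 {H}.
have [a [M [a0 M0 Ha]]] := poly_away0 p0.
have cc := normr_ge0 c.
have ai : 0 < a^-1 by rewrite invr_gt0.
exists (1 + M + a^-1 * (1 + `|c|)).
  by rewrite addr_ge0 ?mulr_ge0 ?addr_ge0 // ltW.
move=> x; rewrite hornerD hornerM hornerX hornerC.
set y := p.[x] * x + c; have yy := normr_ge0 y; have xx := normr_ge0 x.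
have [xM|/ltW /Ha xM] := lerP `|x| M.
  rewrite mulrDr mulr1 -[leLHS]addr0 lerD //; last first.
    by rewrite mulr_ge0 // !addr_ge0 // ?mulr_ge0 ?addr_ge0 // ltW.
  have : 0 <= a^-1 * (1 + `|c|) by rewrite mulr_ge0 ?addr_ge0 // ltW.
  by lra.
have H1 : `|p.[x] * x| <= `|y| + `|c|.
  by rewrite (_ : p.[x] * x = y - c) ?ler_normB // /y addrK.
have H2 : `|x| <= a^-1 * (`|y| + `|c|).
  rewrite -ler_pdivrMl ?invr_gt0 // invrK.
  by apply: le_trans H1; rewrite normrM ler_wpM2r.
have H3 : 0 <= a^-1 * `|c| * `|y| by rewrite !mulr_ge0 // ltW.
have H4 : 0 <= M * `|y| by rewrite mulr_ge0.
apply: (@le_trans _ _ (1 + a^-1 * (`|y| + `|c|))); first by rewrite lerD2l.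
have : 0 <= a^-1 by rewrite ltW.
set b := a^-1 in H3 *; nra.
Qed.

Lemma poly_bound (p : {poly R}) :
  exists C m, 0 <= C /\ forall x, `|p.[x]| <= C * (1 + `|x|) ^+ m.
Proof.
elim/poly_ind: p => [|p c [C [m [C0 H]]]].
  by exists 0, 0%N; split => // x; rewrite horner0 normr0 mul0r.
exists (C + `|c|), m.+1; split; first by rewrite addr_ge0.
move=> x; rewrite hornerD hornerM hornerX hornerC.
have x1 : 1 <= 1 + `|x| by rewrite lerDl.
apply: le_trans (ler_normD _ _) _; rewrite mulrDl lerD //.
  rewrite normrM exprSr mulrA ler_pM // lerDr //.
by rewrite ler_peMr // exprn_ege1.
Qed.

Lemma rrapid_weight u m j : rrapid u ->
  exists2 M : R, 0 <= M & forall y, (1 + `|y|) ^+ m * `|(derive1n j u) y| <= M.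
Proof.
move=> ru; have [A HA] := ru 0%N j; have [B HB] := ru m j.
have A0 : 0 <= A by apply: le_trans (HA 0); rewrite mulr_ge0.
have B0 : 0 <= B by apply: le_trans (HB 0); rewrite mulr_ge0 ?exprn_ge0.
exists (2 ^+ m * (A + B)); first by rewrite mulr_ge0 ?exprn_ge0 ?addr_ge0.
move=> y; have yy := normr_ge0 y; have [y1|y1] := lerP `|y| 1.
  rewrite ler_pM ?exprn_ge0 ?addr_ge0 //.
    by rewrite lerXn2r // ?nnegrE ?addr_ge0 //; lra.
  by have := HA y; rewrite expr0 mul1r; lra.
apply: (@le_trans _ _ (2 ^+ m * (`|y| ^+ m * `|(derive1n j u) y|))).
  rewrite mulrA ler_wpM2r // -exprMn lerXn2r // ?nnegrE ?addr_ge0 //; last lra.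
by rewrite ler_wpM2l ?exprn_ge0 //; have := HB y; lra.
Qed.

Lemma rrapid_comp u (phi : {poly R}) : (1 < size phi)%N -> rsmooth u ->
  rrapid u -> rrapid (u \o horner phi).
Proof.
move=> sphi su ru k n; rewrite derive1n_comp //.
elim: (iter n _ _) => [|[p j] s [N HN]].
  by exists 0 => x; rewrite big_nil normr0 mulr0.
have [C [m [C0 HC]]] := poly_bound p.
have [E E0 HE] := poly_growth sphi.
have [M M0 HM] := @rrapid_weight u (k + m) j ru.
exists (C * E ^+ (k + m) * M + N) => x; rewrite big_cons /=.
set S := \sum_(i <- s) _ in HN *.
apply: (@le_trans _ _ (`|x| ^+ k * (`|p.[x]| * `|(derive1n j u) phi.[x]| + `|S|))).
  by rewrite ler_wpM2l ?exprn_ge0 // -normrM ler_normD.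
rewrite mulrDr lerD // mulrA.
have x0 : 0 <= 1 + `|x| by rewrite addr_ge0.
have f0 : 0 <= 1 + `|phi.[x]| by rewrite addr_ge0.
apply: (@le_trans _ _ (C * (1 + `|x|) ^+ (k + m) * `|(derive1n j u) phi.[x]|)).
  rewrite ler_wpM2r // exprD mulrCA ler_pM ?exprn_ge0 //.
  by rewrite lerXn2r ?nnegrE // lerDr.
rewrite -!mulrA ler_wpM2l //.
apply: (@le_trans _ _
   ((E * (1 + `|phi.[x]|)) ^+ (k + m) * `|(derive1n j u) phi.[x]|)).
  by rewrite ler_wpM2r // lerXn2r ?nnegrE // mulr_ge0.
by rewrite exprMn -mulrA ler_wpM2l ?exprn_ge0.
Qed.

End RealFacts.

Arguments derive1n_lin {R} a b {u v}.
Arguments rsmooth_lin {R} a b {u v}.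
Arguments rrapid_lin {R} a b {u v}.

Section Schwartz.
Variable R : realType.
Implicit Type f g : R -> R[i].

Lemma ReD (a b : R[i]) : complex.Re (a + b) = complex.Re a + complex.Re b.
Proof. by case: a b => [? ?] [? ?]. Qed.

Lemma ImD (a b : R[i]) : complex.Im (a + b) = complex.Im a + complex.Im b.
Proof. by case: a b => [? ?] [? ?]. Qed.

Lemma ReM (a b : R[i]) : complex.Re (a * b) =
  complex.Re a * complex.Re b + - complex.Im a * complex.Im b.
Proof. by case: a b => [? ?] [? ?] /=; rewrite mulNr. Qed.

Lemma ImM (a b : R[i]) : complex.Im (a * b) =
  complex.Im a * complex.Re b + complex.Re a * complex.Im b.
Proof. by case: a b => [? ?] [? ?] /=; rewrite addrC. Qed.

Lemma normc_ge0 (z : R[i]) : 0 <= normc z.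
Proof. by case: z => a b; exact: Num.Theory.sqrtr_ge0. Qed.

Lemma ler_Re_normc (z : R[i]) : `|complex.Re z| <= normc z.
Proof.
by case: z => a b /=; rewrite -sqrtr_sqr ler_sqrt ?addr_ge0 ?sqr_ge0 // lerDl sqr_ge0.
Qed.

Lemma ler_Im_normc (z : R[i]) : `|complex.Im z| <= normc z.
Proof.
by case: z => a b /=; rewrite -sqrtr_sqr ler_sqrt ?addr_ge0 ?sqr_ge0 // lerDr sqr_ge0.
Qed.

Lemma ler_normc_ReIm (z : R[i]) :
  normc z <= `|complex.Re z| + `|complex.Im z|.
Proof.
case: z => a b /=; have aa := normr_ge0 a; have bb := normr_ge0 b.
rewrite -(ger0_norm (addr_ge0 aa bb)) -sqrtr_sqr ler_sqrt ?sqr_ge0 //.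
by rewrite sqrrD !real_normK ?num_real //; have := mulr_ge0 aa bb; lra.
Qed.

Lemma schwartzP f : reflect
  [/\ rsmooth (@complex.Re R \o f), rsmooth (@complex.Im R \o f),
      rrapid (@complex.Re R \o f) & rrapid (@complex.Im R \o f)]
  (f \in schwartz_pred R).
Proof.
apply: (iffP (asboolP (smooth f /\ rapidly_decreasing f))) => [[sf rf]|[s1 s2 r1 r2]].
  split; [by move=> n x; case: (sf n x)|by move=> n x; case: (sf n x)|..];
  move=> k n; have [M HM] := rf k n; exists M => x; apply: le_trans (HM x);
  rewrite ler_wpM2l ?exprn_ge0 //.
  - exact: (ler_Re_normc (cderive1n n f x)).
  - exact: (ler_Im_normc (cderive1n n f x)).
split; first by move=> n x; split; [exact: s1|exact: s2].
move=> k n; have [A HA] := r1 k n; have [B HB] := r2 k n.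
exists (A + B) => x; apply: le_trans (lerD (HA x) (HB x)).
rewrite -mulrDr ler_wpM2l ?exprn_ge0 //.
exact: (ler_normc_ReIm (cderive1n n f x)).
Qed.

Lemma schwartz_submod_closed : submod_closed (schwartz_pred R).
Proof.
have cst0 : [/\ rsmooth (fun _ : R => 0 : R) & rrapid (fun _ : R => 0 : R)].
  have E n : derive1n n (fun _ : R => 0 : R) = fun=> 0.
    elim: n => [//|n IH]; rewrite derive1nS IH; apply/funext => x.
    exact: derive1_cst.
  split; first by move=> n x; rewrite E; exact: derivable_cst.
  by move=> k n; exists 0 => x; rewrite E normr0 mulr0.
case: cst0 => s0 r0; split; first by apply/schwartzP; split.
move=> a f g /schwartzP[f1 f2 f3 f4] /schwartzP[g1 g2 g3 g4].
have s1 := rsmooth_lin (complex.Re a) (- complex.Im a) f1 f2.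
have s2 := rsmooth_lin (complex.Im a) (complex.Re a) f1 f2.
have r1 := rrapid_lin (complex.Re a) (- complex.Im a) f1 f2 f3 f4.
have r2 := rrapid_lin (complex.Im a) (complex.Re a) f1 f2 f3 f4.
have ER : @complex.Re R \o (a *: f + g) = fun x => 1 *
    (complex.Re a * complex.Re (f x) + - complex.Im a * complex.Im (f x)) +
    1 * complex.Re (g x).
  by apply/funext => x /=; rewrite !mul1r -ReM -ReD.
have EI : @complex.Im R \o (a *: f + g) = fun x => 1 *
    (complex.Im a * complex.Re (f x) + complex.Re a * complex.Im (f x)) +
    1 * complex.Im (g x).
  by apply/funext => x /=; rewrite !mul1r -ImM -ImD.
apply/schwartzP; split; rewrite ?ER ?EI.
- exact: (rsmooth_lin 1 1 s1 g1).
- exact: (rsmooth_lin 1 1 s2 g2).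
- exact: (rrapid_lin 1 1 s1 g1 r1 g3).
- exact: (rrapid_lin 1 1 s2 g2 r2 g4).
Qed.

HB.instance Definition _ := GRing.isSubmodClosed.Build _ _ (schwartz_pred R)
  schwartz_submod_closed.

Lemma schwartz_comp f (phi : {poly R}) : (1 < size phi)%N ->
  f \in schwartz_pred R -> f \o horner phi \in schwartz_pred R.
Proof.
move=> sphi /schwartzP[f1 f2 f3 f4]; apply/schwartzP; split.
- exact: (rsmooth_comp f1).
- exact: (rsmooth_comp f2).
- exact: (rrapid_comp sphi f1).
- exact: (rrapid_comp sphi f2).
Qed.

End Schwartz.

Record schwartz (R : realType) := Schwartz {
  schwartz_fun :> R -> R[i];
  schwartz_funP : schwartz_fun \in schwartz_pred R }.

HB.instance Definition _ (R : realType) := [isSub for @schwartz_fun R].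
HB.instance Definition _ (R : realType) := [Choice of schwartz R by <:].
HB.instance Definition _ (R : realType) :=
  [SubChoice_isSubLmodule of schwartz R by <:].

Section Topology.
Variable R : realType.
Implicit Type f g : schwartz R.

Definition schwartz_seminorm (k n : nat) f : R :=
  sup (range (fun x => `|x| ^+ k * normc (cderive1n n f x))).

(* The maxima over k, n <= N form an increasing sequence of seminorms inducing
   the same topology as the whole family schwartz_seminorm k n. *)
Definition schwartz_norm (N : nat) f : R :=
  \big[Num.max/0]_(i : 'I_N.+1 * 'I_N.+1) schwartz_seminorm i.1 i.2 f.

Definition schwartz_ball (N : nat) (e : R) f : set (schwartz R) :=
  [set g | schwartz_norm N (g - f) < e].

Definition schwartz_nbhs f : set_system (schwartz R) :=
  [set A | exists N e, 0 < e /\ schwartz_ball N e f `<=` A].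

Lemma schwartz_seminorm_ub k n f x :
  `|x| ^+ k * normc (cderive1n n f x) <= schwartz_seminorm k n f.
Proof.
have /(@asboolP (smooth f /\ rapidly_decreasing f))[_ /(_ k n)[M HM]] :=
  schwartz_funP f.
by apply: ub_le_sup; [exists M => _ [y _ <-]|exists x].
Qed.

Lemma schwartz_seminorm_le k n f (M : R) :
  (forall x, `|x| ^+ k * normc (cderive1n n f x) <= M) ->
  schwartz_seminorm k n f <= M.
Proof.
move=> H; apply: ge_sup; last by move=> _ [y _ <-].
by exists (`|0 : R| ^+ k * normc (cderive1n n f 0)), 0.
Qed.

Lemma schwartz_seminorm_ge0 k n f : 0 <= schwartz_seminorm k n f.
Proof.
apply: le_trans (schwartz_seminorm_ub k n f 0).
by rewrite mulr_ge0 ?exprn_ge0 ?normc_ge0.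
Qed.

Lemma cderive1nD n f g x :
  cderive1n n (f + g) x = cderive1n n f x + cderive1n n g x.
Proof.
have /schwartzP[f1 f2 _ _] := schwartz_funP f.
have /schwartzP[g1 g2 _ _] := schwartz_funP g.
have ER : @complex.Re R \o (f + g) = fun x =>
   1 * complex.Re (f x) + 1 * complex.Re (g x).
  by apply/funext => y /=; rewrite !mul1r -ReD.
have EI : @complex.Im R \o (f + g) = fun x =>
   1 * complex.Im (f x) + 1 * complex.Im (g x).
  by apply/funext => y /=; rewrite !mul1r -ImD.
rewrite /cderive1n ER EI (derive1n_lin _ _ _ f1 g1) (derive1n_lin _ _ _ f2 g2).
by rewrite !mul1r.
Qed.

Lemma cderive1nZ n (a : R[i]) f x :
  cderive1n n (a *: f) x = a * cderive1n n f x.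
Proof.
have /schwartzP[f1 f2 _ _] := schwartz_funP f.
have ER : @complex.Re R \o (a *: f) = fun x =>
   complex.Re a * complex.Re (f x) + - complex.Im a * complex.Im (f x).
  by apply/funext => y /=; rewrite -ReM.
have EI : @complex.Im R \o (a *: f) = fun x =>
   complex.Im a * complex.Re (f x) + complex.Re a * complex.Im (f x).
  by apply/funext => y /=; rewrite -ImM.
rewrite /cderive1n ER EI (derive1n_lin _ _ _ f1 f2) (derive1n_lin _ _ _ f1 f2).
by case: a {ER EI} => a b /=; congr Complex; rewrite ?mulNr // addrC.
Qed.

Lemma schwartz_seminormD k n f g : schwartz_seminorm k n (f + g) <=
  schwartz_seminorm k n f + schwartz_seminorm k n g.
Proof.
apply: schwartz_seminorm_le => x; rewrite cderive1nD.
apply: le_trans (lerD (schwartz_seminorm_ub k n f x)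
  (schwartz_seminorm_ub k n g x)).
rewrite -mulrDr ler_wpM2l ?exprn_ge0 //; exact: le_normcD.
Qed.

Lemma schwartz_seminormZ k n (a : R[i]) f : schwartz_seminorm k n (a *: f) <=
  normc a * schwartz_seminorm k n f.
Proof.
apply: schwartz_seminorm_le => x; rewrite cderive1nZ normcM mulrCA.
by rewrite ler_wpM2l ?normc_ge0 // schwartz_seminorm_ub.
Qed.

Lemma schwartz_norm_ub N (i : 'I_N.+1 * 'I_N.+1) f :
  schwartz_seminorm i.1 i.2 f <= schwartz_norm N f.
Proof.
exact: (le_bigmax _ (fun j : 'I_N.+1 * 'I_N.+1 => schwartz_seminorm j.1 j.2 f)).
Qed.

Lemma schwartz_norm_ge0 N f : 0 <= schwartz_norm N f.
Proof.
by apply: le_trans (schwartz_norm_ub (ord0, ord0) f); exact: schwartz_seminorm_ge0.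
Qed.

Lemma schwartz_normD N f g :
  schwartz_norm N (f + g) <= schwartz_norm N f + schwartz_norm N g.
Proof.
apply: bigmax_le => [|i _]; first by rewrite addr_ge0 ?schwartz_norm_ge0.
by apply: le_trans (schwartz_seminormD _ _ _ _) _; rewrite lerD ?schwartz_norm_ub.
Qed.

Lemma schwartz_normZ N (a : R[i]) f :
  schwartz_norm N (a *: f) <= normc a * schwartz_norm N f.
Proof.
apply: bigmax_le => [|i _].
  by rewrite mulr_ge0 ?schwartz_norm_ge0 ?normc_ge0.
apply: le_trans (schwartz_seminormZ _ _ _ _) _.
by rewrite ler_wpM2l ?normc_ge0 ?schwartz_norm_ub.
Qed.

Lemma schwartz_norm0 N : schwartz_norm N 0 = 0.
Proof.
apply/eqP; rewrite eq_le schwartz_norm_ge0 andbT.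
by have := schwartz_normZ N 0 0; rewrite scale0r normc0 mul0r.
Qed.

Lemma schwartz_normS N M f : (N <= M)%N -> schwartz_norm N f <= schwartz_norm M f.
Proof.
move=> NM; apply: bigmax_le => [|[i j] _ /=]; first exact: schwartz_norm_ge0.
have NM' : (N.+1 <= M.+1)%N by [].
exact: (schwartz_norm_ub (widen_ord NM' i, widen_ord NM' j)).
Qed.

Lemma schwartz_ball_center N e f : 0 < e -> schwartz_ball N e f f.
Proof. by rewrite /schwartz_ball /= subrr schwartz_norm0. Qed.

Lemma schwartz_ball_sub N e f g : schwartz_ball N e f g ->
  schwartz_ball N (e - schwartz_norm N (g - f)) g `<=` schwartz_ball N e f.
Proof.
rewrite /schwartz_ball /= => H h /= Hh.
rewrite -[h](subrK g) -addrA; apply: le_lt_trans (schwartz_normD _ _ _) _.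
by rewrite -ltrBrDr.
Qed.

HB.instance Definition _ := hasNbhs.Build (schwartz R) schwartz_nbhs.

Lemma schwartz_nbhs_ball N e f : 0 < e -> nbhs f (schwartz_ball N e f).
Proof. by move=> e0; exists N, e; split => //; exact: subset_refl. Qed.

Lemma schwartz_nbhs_filter f : ProperFilter (nbhs f).
Proof.
rewrite /nbhs /=; apply: Build_ProperFilter_ex.
  move=> A [N [e [e0 H]]]; exists f; apply: H; exact: schwartz_ball_center.
split.
- by exists 0%N, 1; split=> [|//]; exact: ltr01.
- move=> A B [N [e [e0 HA]]] [M [d [d0 HB]]].
  exists (maxn N M), (Num.min e d); split; first by rewrite lt_min e0.
  move=> g; rewrite /schwartz_ball /= lt_min => /andP[H1 H2]; split.
    by apply: HA; apply: le_lt_trans H1; apply: schwartz_normS; exact: leq_maxl.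
  by apply: HB; apply: le_lt_trans H2; apply: schwartz_normS; exact: leq_maxr.
- by move=> A B AB [N [e [e0 H]]]; exists N, e; split => //; exact: subset_trans AB.
Qed.

Lemma schwartz_nbhs_singleton f (A : set (schwartz R)) : nbhs f A -> A f.
Proof. by move=> [N [e [e0 H]]]; apply: H; exact: schwartz_ball_center. Qed.

Lemma schwartz_nbhs_nbhs f (A : set (schwartz R)) :
  nbhs f A -> nbhs f (nbhs^~ A).
Proof.
move=> [N [e [e0 H]]]; rewrite /nbhs /=; exists N, e; split => // g Hg.
exists N, (e - schwartz_norm N (g - f)); split; first by rewrite subr_gt0.
by apply: subset_trans H; exact: schwartz_ball_sub.
Qed.

HB.instance Definition _ := Nbhs_isNbhsTopological.Build (schwartz R)
  schwartz_nbhs_filter schwartz_nbhs_singleton schwartz_nbhs_nbhs.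

Lemma schwartz_ball_open N e f : open (schwartz_ball N e f).
Proof.
rewrite openE => g Hg; rewrite /interior /nbhs /=; exists N, (e - schwartz_norm N (g - f)).
by split; [rewrite subr_gt0|exact: schwartz_ball_sub].
Qed.

Lemma schwartz_add_continuous :
  continuous (fun z : schwartz R * schwartz R => z.1 + z.2).
Proof.
move=> [f g] A [N [e [e0 H]]].
have e2 : 0 < e / 2 by rewrite divr_gt0.
exists (schwartz_ball N (e / 2) f, schwartz_ball N (e / 2) g).
  by split; exact: schwartz_nbhs_ball.
move=> [f' g'] [/= Hf Hg]; apply: H; rewrite /schwartz_ball /= in Hf Hg *.
have := schwartz_normD N (f' - f) (g' - g).
by rewrite (_ : f' - f + (g' - g) = f' + g' - (f + g)) 1?opprD 1?addrACA //; lra.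
Qed.

Lemma schwartz_scale_continuous :
  continuous (fun z : R[i]^o * schwartz R => z.1 *: z.2).
Proof.
move=> [a f] A [N [e [e0 H]]].
set p := schwartz_norm N f.
have p0 : 0 <= p := schwartz_norm_ge0 N f.
have a0 := normc_ge0 a.
pose d := Num.min 1 (e / (1 + normc a + p)).
have s0 : 0 < 1 + normc a + p by rewrite -addrA ltr_pwDl ?addr_ge0.
have d0 : 0 < d by rewrite lt_min ltr01 divr_gt0.
have dC0 : 0 < d%:C :> R[i] by rewrite ltcR.
exists (ball (a : R[i]^o) d%:C, schwartz_ball N d f).
  by split; [exact: nbhsx_ballx|exact: schwartz_nbhs_ball].
move=> [b g] [/=]; rewrite -ball_normE /ball_ /= => Hb Hg.
have {}Hb : normc (b - a) < d.
  by rewrite -ltcR; move: Hb; rewrite distrC.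
apply: H; rewrite /schwartz_ball /= in Hg *.
have -> : b *: g - a *: f = (b - a) *: (g - f) + ((b - a) *: f + a *: (g - f)).
  by rewrite !scalerBr !scalerBl addrA subrK addrA subrK.
have q0 := schwartz_norm_ge0 N (g - f).
have b0 := normc_ge0 (b - a).
have d1 : d <= 1 by rewrite ge_min lexx.
have de : d * (1 + normc a + p) <= e.
  by rewrite -ler_pdivlMr // ge_min lexx orbT.
set q := schwartz_norm N (g - f) in Hg q0.
have h1 : schwartz_norm N ((b - a) *: (g - f)) <= normc (b - a).
  apply: le_trans (schwartz_normZ _ _ _) _.
  by rewrite ler_piMr //; exact: le_trans (ltW Hg) d1.
have h2 : schwartz_norm N ((b - a) *: f) <= d * p.
  apply: le_trans (schwartz_normZ _ _ _) _.
  by rewrite ler_wpM2r // ltW.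
have h3 : schwartz_norm N (a *: (g - f)) <= d * normc a.
  apply: le_trans (schwartz_normZ _ _ _) _.
  by rewrite mulrC ler_wpM2r // ltW.
have h4 := schwartz_normD N ((b - a) *: (g - f))
  ((b - a) *: f + a *: (g - f)).
have h5 := schwartz_normD N ((b - a) *: f) (a *: (g - f)).
apply: le_lt_trans h4 (lt_le_trans _ de); rewrite !mulrDr mulr1 -addrA.
apply: ltr_leD; first exact: le_lt_trans h1 Hb.
by apply: le_trans h5 _; rewrite addrC lerD.
Qed.

Lemma schwartz_ball_convex N e f g h (c : R[i]) : 0 < c -> c < 1 ->
  schwartz_ball N e f g -> schwartz_ball N e f h ->
  schwartz_ball N e f (c *: g + (1 - c) *: h).
Proof.
move=> k0 k1; rewrite /schwartz_ball /= => Hg Hh.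
pose t : R := complex.Re c.
have ct : c = t%:C by rewrite RRe_real // ger0_real // ltW.
have t0 : 0 < t by rewrite -ltcR -ct.
have t1 : 0 < 1 - t by rewrite subr_gt0 -ltcR -ct.
have E : 1 - c = (1 - t)%:C by rewrite ct rmorphB.
have -> : c *: g + (1 - c) *: h - f = c *: (g - f) + (1 - c) *: (h - f).
  have F : f = c *: f + (1 - c) *: f.
    by rewrite -scalerDl [c + _]addrC subrK scale1r.
  by rewrite [in LHS]F opprD addrACA -!scalerBr.
have nr (r : R) : 0 < r -> normc (r%:C) = r.
  by move=> r0; rewrite /= expr0n addr0 sqrtr_sqr gtr0_norm.
have h1 := schwartz_normZ N (t%:C) (g - f).
have h2 := schwartz_normZ N ((1 - t)%:C) (h - f).
rewrite nr // in h1; rewrite nr // in h2.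
rewrite E ct; apply: le_lt_trans (schwartz_normD _ _ _) _.
apply: le_lt_trans (lerD h1 h2) _.
have -> : e = t * e + (1 - t) * e by rewrite -mulrDl addrC subrK mul1r.
by rewrite ltrD // ltr_pM2l.
Qed.

Lemma schwartz_locally_convex : exists2 B : set_system (schwartz R),
  (forall b, b \in B -> convex_set b) & basis B.
Proof.
exists [set A | exists N e f, A = schwartz_ball N e f].
  move=> _ /set_mem [N [e [f ->]]]; apply/convex_setW => g h.
  move=> /set_mem Hg /set_mem Hh k k0 k1; apply/mem_set.
  exact: (schwartz_ball_convex k0 k1 Hg Hh).
split; first by move=> _ [N [e [f ->]]]; exact: schwartz_ball_open.
move=> f A [N [e [e0 HA]]]; exists (schwartz_ball N e f) => //.
by split; [exists N, e, f|exact: schwartz_ball_center].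
Qed.

(* This factory declares the uniform structure only. *)
HB.instance Definition _ := PreTopologicalLmod_isTvs.Build R[i] (schwartz R)
  schwartz_add_continuous schwartz_scale_continuous schwartz_locally_convex.
HB.instance Definition _ := PreTopologicalNmodule_isTopologicalNmodule.Build
  (schwartz R) schwartz_add_continuous.
HB.instance Definition _ := TopologicalNmodule_isTopologicalLmodule.Build
  R[i] (schwartz R) schwartz_scale_continuous.
HB.instance Definition _ := Uniform_isTvs.Build R[i] (schwartz R)
  schwartz_locally_convex.

End Topology.

Section CompositionOperator.
(* size phi is the degree plus one: phi is non-constant. *)
Variables (R : realType) (phi : {poly R}) (hphi : (1 < size phi)%N).

Definition comp_fun (f : schwartz R) : schwartz R :=
  Schwartz (schwartz_comp hphi (schwartz_funP f)).

Lemma comp_fun_is_linear : linear comp_fun.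
Proof. by move=> a f g; exact: val_inj. Qed.

HB.instance Definition _ := GRing.isLinear.Build R[i] (schwartz R) (schwartz R)
  _ comp_fun comp_fun_is_linear.

Definition comp_op : {linear schwartz R -> schwartz R} := comp_fun.

End CompositionOperator.

(* Main.v *)
Require Import Defs.
From mathcomp Require Import all_boot all_order all_algebra.
From mathcomp Require Import complex.
From mathcomp Require Import all_classical all_reals all_analysis.
From mathcomp Require Import ring lra.

(** For [0 < |l| <= 1] the operator [f |-> f \o phi - l *: f] is not even
    surjective. Suppose that [f \o phi = l *: f + g] is solvable for every [g].

    Since [phi] has degree at least two, [|phi x| >= 2 |x|] for [x] large. If
    [phi \o phi] tends to [+oo] at [+oo] (otherwise reflect the line), let [b]
    be its largest fixed point and start from a large [x 0 > b]. The forward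
    orbit of [x 0] grows at least geometrically, and the intermediate value
    theorem yields a backward orbit [x n], with [phi (x n.+1) = x n], whose even
    terms decrease to [b]. In this two-sided orbit [x 0] is an isolated point
    ([poly_isolated_orbit]).

    Let [g] be a smooth bump concentrated near [x 0] ([schwartz_bump]). Along
    the forward orbit from [phi (x 0)], [f] is multiplied by [l] at each step;
    as it decreases faster than any power of its geometrically growing
    argument, it vanishes there ([schwartz_fast_orbit]). The equation at [x 0]
    then makes [f (x 0)] nonzero, and along the backward orbit [f] is divided by
    [l] at each step, so [|f (x n)| >= |f (x 0)|]. By continuity [f b] is not
    zero.

    But [g] vanishes at [b] and [phi b], so [f b = l ^+ 2 * f b], with
    [f b = l * f b] when [b] is fixed by [phi]. Hence [l ^+ 2 = 1], respectively
    [l = 1], and in that case a right-hand side that is nonzero at [b] and zero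
    at [phi b], if this is another point, contradicts the equation read on the
    cycle of [b] ([isolated_orbit_not_surjective]). *)

Set Implicit Arguments.
Unset Strict Implicit.

Import Order.TTheory GRing.Theory Num.Theory.
Import numFieldTopology.Exports numFieldNormedType.Exports.
Import Normc.

Local Open Scope ring_scope.
Local Open Scope complex_scope.
Local Open Scope classical_set_scope.

(** * Smooth bump functions *)

Section Bump.
Variable R : realType.
Implicit Types (p : {poly R}) (u : R -> R) (c e t x : R).

Lemma is_derive_quadratic_bound u (C : R) :
  (forall t, `|u t| <= C * t ^+ 2) -> is_derive (0 : R) (1 : R) u 0.
Proof.
move=> H.
have u0 : u 0 = 0.
  by have := H 0; rewrite expr0n mulr0 normr_le0 => /eqP.
have C0 : 0 <= C.
  by have := H 1; rewrite expr1n mulr1; apply: le_trans.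
have cv : h^-1 *: ((u \o shift 0) (h *: 1) - u 0) @[h --> 0^'] --> (0 : R).
  apply/cvgr0Pnorm_lt => d d0.
  near=> h.
  have h0 : h != 0 by near: h; exact: nbhs_dnbhs_neq.
  rewrite /= addr0 u0 subr0 [h *: 1]mulr1 normrM normfV.
  rewrite mulrC ltr_pdivrMr ?normr_gt0 //.
  apply: le_lt_trans (H h) _.
  rewrite -real_normK ?num_real // expr2 mulrA ltr_pM2r ?normr_gt0 //.
  apply: (@le_lt_trans _ _ ((C + 1) * `|h|)); first by rewrite ler_wpM2r ?lerDl.
  rewrite mulrC -ltr_pdivlMr ?ltr_wpDl //.
  near: h; apply: dnbhs0_lt; by rewrite divr_gt0 ?ltr_wpDl.
apply: DeriveDef; first by apply/cvg_ex; exists 0.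
exact: (cvg_lim (@Rhausdorff R) cv).
Unshelve. all: by end_near. Qed.

(** The classical flat function is the case [p = 1]; the factor [p.[1/x]] makes
    the family stable under differentiation. *)
Definition flat p x : R := if 0 < x then p.[x^-1] * expR (- x^-1) else 0.

Lemma exprn_le_expR n x : 0 <= x -> x ^+ n.+1 <= (n.+1)`!%:R * expR x.
Proof.
move=> x0; rewrite mulrC -ler_pdivrMr ?ltr0n ?fact_gt0 //.
by apply: le_trans (expR_ge1Dxn n x0); rewrite lerDr.
Qed.

(** With [y = 1/t] this says that [y ^+ 2 * p.[y] * expR (- y)] is bounded for
    [0 < y]: the exponential beats every polynomial. It is what makes [flat p]
    differentiable at the origin, with derivative [0]. *)
Lemma flat_quadratic p : exists C, forall t, `|flat p t| <= C * t ^+ 2.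
Proof.
have [C [m [C0 HC]]] := poly_bound p.
(* The factor [expR 1] comes from comparing [(1 + y) ^+ m.+2], and not
   [y ^+ m.+2], with the exponential. *)
pose D := C * ((m.+2)`!%:R * expR 1).
have D0 : 0 <= D by rewrite !mulr_ge0 ?expR_ge0.
exists D => t; rewrite /flat; case: ifPn => [t0|_]; last first.
  by rewrite normr0 mulr_ge0 ?sqr_ge0.
set y := t^-1; have y0 : 0 < y by rewrite invr_gt0.
have -> : t = y^-1 by rewrite invrK.
rewrite normrM (ger0_norm (expR_ge0 _)) exprVn ler_pdivlMr ?exprn_gt0 //.
apply: (@le_trans _ _ (C * (1 + y) ^+ m.+2 * expR (- y))).
  rewrite mulrAC ler_wpM2r ?expR_ge0 //.
  apply: (@le_trans _ _ (C * (1 + `|y|) ^+ m * y ^+ 2)).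
    by rewrite ler_wpM2r ?sqr_ge0.
  rewrite gtr0_norm // -mulrA ler_wpM2l // -[m.+2]addn2 exprD ler_wpM2l //.
    by rewrite exprn_ge0 ?addr_ge0 // ltW.
  by rewrite lerXn2r ?nnegrE ?addr_ge0 ?lerDr // ltW.
rewrite /D -[leLHS]mulrA ler_wpM2l //.
have -> : expR 1 = expR (1 + y) * expR (- y) :> R.
  by rewrite -expRD addrK.
by rewrite [leRHS]mulrA ler_wpM2r ?expR_ge0 // exprn_le_expR // addr_ge0 // ltW.
Qed.

(** The chain rule turns [p.[1/x] * expR (- 1/x)] into [1/x^2 * (p - p')] at
    [1/x], times the same exponential: again a member of the family. *)
Lemma is_derive_flat p x :
  is_derive x (1 : R) (flat p) (flat ('X^2 * (p - deriv p)) x).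
Proof.
have [x0|x0|->] := ltgtP x 0.
- rewrite {2}/flat ltNge (ltW x0) /=.
  apply: (@near_eq_is_derive _ _ _ (cst 0)).
  by near=> z; rewrite /flat ltNge ltW //; near: z; exact: lt_nbhsl.
- rewrite {2}/flat x0.
  have xn : x != 0 by rewrite gt_eqF.
  have iv : is_derive x (1 : R) (fun z : R => z^-1) (- x ^- 2).
    have := @is_deriveV R id x 1 1 xn (is_derive_id _ _).
    by rewrite /= /GRing.scale /= mulr1.
  have nv : is_derive x (1 : R) (fun z : R => - z^-1) (x ^- 2).
    by have := @is_deriveN _ _ _ _ _ _ _ iv; rewrite opprK.
  have d1 : is_derive x (1 : R) (horner p \o (fun z : R => z^-1))
      ((deriv p).[x^-1] * - x ^- 2).
    by apply: is_derive1_comp.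
  have d2 : is_derive x (1 : R) (expR \o (fun z : R => - z^-1))
      (expR (- x^-1) * x ^- 2) by apply: is_derive1_comp.
  have := @is_deriveM _ _ _ _ _ _ _ _ d1 d2.
  rewrite /GRing.scale /= => H.
  have {}H : is_derive x (1 : R) (fun z => p.[z^-1] * expR (- z^-1))
      (('X^2 * (p - deriv p)).[x^-1] * expR (- x^-1)).
    by apply: is_derive_eq; rewrite !hornerE /=; field.
  apply: near_eq_is_derive H.
  by near=> z; rewrite /flat ifT //; near: z; exact: lt_nbhsr.
- rewrite {2}/flat ltxx; have [C HC] := flat_quadratic p.
  exact: is_derive_quadratic_bound HC.
Unshelve. all: by end_near. Qed.

Lemma rsmooth_flat p : rsmooth (flat p).
Proof.
have E n : exists q, (flat p)^`(n) = flat q.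
  elim: n => [|n [q IH]]; first by exists p.
  exists ('X^2 * (q - deriv q)); rewrite derive1nS IH; apply/funext => x.
  by rewrite derive1E; have H := is_derive_flat q x; rewrite derive_val.
move=> n x; have [q ->] := E n.
by have H := is_derive_flat q x; exact: ex_derive.
Qed.

Lemma derive1n_eq0 u (A : set R) n x :
  open A -> (forall y, A y -> u y = 0) -> A x -> u^`(n) x = 0.
Proof.
move=> oA u0; elim: n x => [|n IH] x Ax; first exact: u0.
rewrite derive1nS derive1E.
have H : is_derive x (1 : R) (u^`(n)) 0.
  apply: (@near_eq_is_derive _ _ _ (cst 0)).
  near=> z; rewrite /= IH //; near: z; exact: open_nbhs_nbhs.
by rewrite derive_val.
Unshelve. all: by end_near. Qed.

Lemma rsmooth_continuous u n : rsmooth u -> continuous (u^`(n)).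
Proof.
by move=> su x; apply/differentiable_continuous/derivable1_diffP; exact: su.
Qed.

Lemma rrapid_compact_support u c e : rsmooth u ->
  (forall x, e < `|x - c| -> u x = 0) -> rrapid u.
Proof.
move=> su u0 k n.
have off x : e < `|x - c| -> u^`(n) x = 0.
  apply: (@derive1n_eq0 _ [set y | e < `|y - c|]) => //.
  apply: (@open_comp _ _ (fun y : R => `|y - c|) [set z | e < z]); last exact: open_gt.
  by move=> y _; apply: cvg_norm; apply: cvgB => //; exact: cvg_cst.
have [e0|e0] := ltP e 0.
  by exists 0 => x; rewrite off ?normr0 ?mulr0 // (lt_le_trans e0).
have [||M _ HM] := @EVT_max R (fun x => `|x| ^+ k * `|u^`(n) x|) (c - e) (c + e).
  by lra.
  apply: continuous_subspaceT => x.
  apply: cvgM; last by apply: cvg_norm; exact: rsmooth_continuous.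
  apply: (@continuous_comp _ _ _ (fun y : R => `|y|) (fun y => y ^+ k)).
    exact: norm_continuous.
  exact: exprn_continuous.
exists (`|M| ^+ k * `|u^`(n) M|) => x.
have [xe|xe] := ltP e `|x - c|.
  by rewrite off // normr0 mulr0 mulr_ge0 ?exprn_ge0.
apply: HM; rewrite in_itv /=; move: xe; rewrite ler_distl; lra.
Qed.

(** The bump is [flat 1] composed with the polynomial [e^2 - (x - c)^2], so its
    smoothness is that of a composition with a polynomial. *)
Lemma schwartz_bump c e : 0 < e ->
  exists g : schwartz R, g c != 0 /\ forall x, e <= `|x - c| -> g x = 0.
Proof.
move=> e0; pose q : {poly R} := (e ^+ 2)%:P - ('X - c%:P) ^+ 2.
have qE x : q.[x] = e ^+ 2 - `|x - c| ^+ 2.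
  by rewrite !hornerE real_normK ?num_real.
pose u := flat 1 \o horner q.
have u0 x : e <= `|x - c| -> u x = 0.
  move=> h; rewrite /u /= /flat ifF // qE subr_gt0; apply/negbTE.
  by rewrite -leNgt lerXn2r // nnegrE ltW.
have su : rsmooth u by apply: rsmooth_comp; exact: rsmooth_flat.
have ru : rrapid u by apply: (@rrapid_compact_support _ c e) => // x /ltW /u0.
have S : (fun x => (u x)%:C) \in schwartz_pred R.
  have /schwartzP[s0 _ r0 _] := schwartz_funP (0 : schwartz R).
  by apply/schwartzP; split.
exists (Schwartz S); split => [|x /u0 /= -> //].
rewrite /= eq_complex /= eqxx andbT /u /= /flat qE subrr normr0 expr0n subr0.
by rewrite exprn_gt0 // hornerC mul1r gt_eqF ?expR_gt0.
Qed.

End Bump.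

(** * Isolated orbits of expanding maps of the line *)

Section Dynamics.
Variable R : realType.
Implicit Types (f phi psi : R -> R) (b x y K : R).

Lemma continuous_zero f x y : continuous f -> f x <= 0 -> 0 <= f y ->
  exists2 c, Num.min x y <= c & f c = 0.
Proof.
move=> cf fx fy.
have [xy|/ltW yx] := leP x y.
  have [||c + fc] := @IVT R f x y 0 xy; first exact: continuous_subspaceT.
    by rewrite ge_min le_max fx fy orbT.
  by rewrite in_itv /= => /andP[xc _]; exists c.
have [||c + fc] := @IVT R f y x 0 yx; first exact: continuous_subspaceT.
  by rewrite ge_min le_max fx fy orbT.
by rewrite in_itv /= => /andP[xc _]; exists c.
Qed.

Lemma continuous_subid f : continuous f -> continuous (fun x => f x - x).
Proof. by move=> cf x; apply: cvgB; [exact: cf|exact: cvg_id]. Qed.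

(** [b] is the supremum of the fixed points, itself fixed since they form a
    closed set. To the right of [b], [psi] cannot cross the diagonal, and far to
    the right it lies above it. *)
Lemma largest_fixed_point psi K : continuous psi -> (exists a, psi a = a) ->
  (forall y, K <= y -> y < psi y) ->
  exists b, psi b = b /\ forall x, b < x -> x < psi x.
Proof.
move=> cpsi [a fa] HK.
pose A := [set x | psi x = x].
have ubA : has_ubound A.
  by exists K => x Ax; rewrite leNgt; apply/negP => /ltW /HK; rewrite Ax ltxx.
have A0 : A !=set0 by exists a.
have cA : closed A.
  have -> : A = (fun x => psi x - x) @^-1` [set 0].
    by apply/seteqP; split=> x /= => [->|/eqP]; rewrite ?subrr ?subr_eq0 // => /eqP.
  by apply: closed_comp => [x _|]; [exact: continuous_subid|exact: closed_eq].
exists (sup A); split.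
  by have := closure_sup A0 ubA; rewrite -(closure_id A).1.
move=> x bx; rewrite ltNge; apply/negP => psix.
have [|| c + /eqP] := @continuous_zero _ x K (continuous_subid cpsi).
- by rewrite subr_le0.
- by rewrite subr_ge0 ltW // HK.
rewrite subr_eq0 => + /eqP cc; rewrite ge_min => /orP[xc|Kc].
  by have := lt_le_trans bx xc; rewrite ltNge (ub_le_sup ubA).
by have := HK _ Kc; rewrite cc ltxx.
Qed.

(** Each [x > b] has a preimage between [b] and [x] by the intermediate value
    theorem. Iterating gives a decreasing sequence whose limit is a fixed point
    not less than [b], hence [b] itself. *)
Lemma backward_orbit psi b x0 : continuous psi -> psi b = b ->
  (forall x, b < x -> x < psi x) -> b < x0 ->
  exists z : nat -> R, [/\ z 0%N = x0, forall n, b < z n,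
    forall n, psi (z n.+1) = z n & z @ \oo --> b].
Proof.
move=> cpsi fb Hb bx0.
have pre x : exists w, b < x -> b < w /\ psi w = x.
  have [bx|] := ltP b x; last by exists 0.
  have cf : continuous (fun w => psi w - x).
    by move=> w; apply: cvgB; [exact: cpsi|exact: cvg_cst].
  have [||c + /eqP] := @continuous_zero _ b x cf.
  - by rewrite fb subr_le0 ltW.
  - by rewrite subr_ge0 ltW // Hb.
  rewrite subr_eq0 ge_min => + /eqP cx; move=> bc; exists c => _; split=> //.
  have {}bc : b <= c by case/orP: bc => // /(le_trans (ltW bx)).
  rewrite lt_neqAle bc andbT; apply/eqP => E.
  by move: bx; rewrite -cx -E fb ltxx.
have [h Hh] := choice pre.
pose z n := iter n h x0.
have zb n : b < z n by elim: n => //= n /Hh[].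
have zS n : psi (z n.+1) = z n by have [] := Hh _ (zb n).
have zdec n : z n.+1 <= z n by rewrite -[leRHS]zS ltW // Hb.
have zcv : cvgn z.
  apply: nonincreasing_is_cvgn; first exact/nonincreasing_seqP.
  by exists b => _ [n _ <-]; exact: ltW.
exists z; split => //.
have bl : b <= limn z by apply: limr_ge => //; near=> n; exact: ltW.
suff -> : b = limn z by [].
apply/eqP; rewrite eq_le bl /= leNgt; apply/negP => /Hb.
suff -> : psi (limn z) = limn z by rewrite ltxx.
have c1 : (fun n => psi (z n.+1)) @ \oo --> psi (limn z).
  by apply: continuous_cvg; [exact: cpsi|rewrite cvg_shiftS].
have E : (fun n => psi (z n.+1)) = z by apply/funext.
by rewrite E in c1; rewrite -(cvg_lim (@Rhausdorff R) c1).
Unshelve. all: by end_near. Qed.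

(** [phi] has no fixed point beyond [b], so its graph stays on one side of the
    diagonal there. If it stays below, a value [phi y > b] would be decreased
    once more by [phi], against [y < phi (phi y)]. *)
Lemma above_or_below_diagonal phi b : continuous phi ->
  (forall x, b < x -> x < phi (phi x)) ->
  (forall x, b < x -> x < phi x) \/ (forall x, b < x -> phi x <= b).
Proof.
move=> cphi H.
have nfix x : b < x -> phi x <> x by move=> /[dup] bx /H + E; rewrite !E ltxx.
have [up|/existsNP[x]] := pselect (forall x, b < x -> x < phi x); first by left.
move=> /not_implyP[bx /negP]; rewrite -leNgt => phix; right.
have below y : b < y -> phi y < y.
  move=> by_; rewrite ltNge; apply/negP => yphi.
  have [||c + /eqP] := @continuous_zero _ x y (continuous_subid cphi).
  - by rewrite subr_le0.
  - by rewrite subr_ge0.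
  rewrite subr_eq0 => + /eqP; move=> mc; apply: nfix.
  by apply: lt_le_trans mc; rewrite lt_min bx.
move=> y yb; rewrite leNgt; apply/negP => /below pp.
by have := lt_trans (lt_trans (H _ yb) pp) (below _ yb); rewrite ltxx.
Qed.

Lemma iter_double phi k x :
  iter k.*2 phi x = iter k (fun y => phi (phi y)) x.
Proof. by elim: k => //= k ->. Qed.

(** The sequence [x] is a backward orbit of [x 0]; together with the forward
    orbit it visits the [e]-neighbourhood of [x 0] only once. Growth and
    convergence are asked at even times because [phi] may reverse orientation
    (as [- x ^+ 3] does): the orbit then alternates between two sides, and
    accumulates at a cycle of period two. *)
Definition has_isolated_orbit phi := exists (x : nat -> R) (b e : R),
  [/\ 0 < e, forall n, phi (x n.+1) = x n,
      forall n, e <= `|x n.+1 - x 0%N|,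
      forall n, e <= `|iter n.+1 phi (x 0%N) - x 0%N| &
      (forall k, 2 ^+ k <= `|iter k.*2 phi (x 0%N)|) /\
      (fun k => x k.*2) @ \oo --> b].

(** The even terms of the orbit come from [psi = phi \o phi], which lies above
    the diagonal beyond its largest fixed point [b]; the odd ones are their
    images under [phi]. If [phi] is above the diagonal beyond [b], the whole
    orbit is monotone; otherwise the odd terms stay below [b]. Either way the
    orbit leaves [x 0] isolated. *)
Lemma isolated_orbit_up phi K : continuous phi -> (exists a, phi a = a) ->
  0 < K -> (forall y, K <= y -> 2 * y <= phi (phi y)) -> has_isolated_orbit phi.
Proof.
move=> cphi [a fa] K0 HK; pose psi x := phi (phi x).
have cpsi : continuous psi by move=> x; apply: continuous_comp; exact: cphi.
have [||b [fb Hb]] := @largest_fixed_point psi K cpsi.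
- by exists a; rewrite /psi !fa.
- by move=> y Ky; have := HK _ Ky; rewrite -/(psi y); lra.
(* Starting beyond [K] and [1] makes the forward orbit at least double at each
   application of [psi], from a value at least one. *)
pose x0 := Num.max (b + 1) (Num.max K 1).
have bx0 : b < x0 by rewrite lt_max ltrDl ltr01.
have Kx0 : K <= x0 by rewrite !le_max lexx orbT.
have x01 : 1 <= x0 by rewrite !le_max lexx !orbT.
have [z [z0 zb zS zl]] := backward_orbit cpsi fb Hb bx0.
have zlt n : z n.+1 < z n by rewrite -(zS n) Hb.
have zle n : z n.+1 <= z 1%N.
  by elim: n => // n IH; apply: le_trans IH; exact: ltW.
have growth k : [/\ 2 ^+ k <= iter k psi x0 & K <= iter k psi x0].
  elim: k => [|k [IH1 IH2]]; first by rewrite expr0.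
  have H := HK _ IH2; rewrite iterS exprS; split; last by rewrite -/psi /psi; lra.
  by apply: le_trans H; rewrite ler_pM2l.
have orb k : b < iter k psi x0.
  by elim: k => //= k IH; apply: lt_trans (Hb _ IH).
have psi_ge k : psi x0 <= iter k.+1 psi x0.
  by elim: k => // k IH; apply: le_trans IH (ltW _); exact/Hb/orb.
pose x n := if odd n then phi (z n./2.+1) else z n./2.
have x00 : x 0%N = x0 by rewrite /x /= z0.
have xS n : phi (x n.+1) = x n.
  rewrite /x /= uphalf_half; case: (odd n) => //=.
  by rewrite add0n -[RHS]zS.
exists x, b.
(* The neighbours of [x0] in the orbit are the closest terms: [x 1] and [phi x0]
   when the orbit is monotone, [x 2] and [psi x0] when it alternates. *)
have core : exists2 e, 0 < e & forall n, x n.+1 <= x0 - e /\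
    (x0 + e <= iter n.+1 phi x0 \/ iter n.+1 phi x0 <= x0 - e).
  have [up|down] := above_or_below_diagonal cphi Hb.
    exists (Num.min (x0 - phi (z 1%N)) (phi x0 - x0)).
      rewrite lt_min !subr_gt0 up // andbT -z0 -(zS 0%N) up //.
      exact: lt_trans (zb _) (up _ (zb _)).
    have h1 : Num.min (x0 - phi (z 1%N)) (phi x0 - x0) <= x0 - phi (z 1%N).
      by rewrite ge_min lexx.
    have h2 : Num.min (x0 - phi (z 1%N)) (phi x0 - x0) <= phi x0 - x0.
      by rewrite ge_min lexx orbT.
    move: (Num.min _ _) h1 h2 => e h1 h2 n; split.
      have : x n.+1 <= phi (z 1%N).
        have xb m : b < x m.
          by rewrite /x; case: ifP => _ //; apply: lt_trans (up _ _).
        elim: n => [|n IH]; first by rewrite /x.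
        by apply: le_trans IH; rewrite -[leRHS]xS ltW // up.
      lra.
    left; suff : phi x0 <= iter n.+1 phi x0 by lra.
    have /andP[] // : (phi x0 <= iter n.+1 phi x0) && (b < iter n.+1 phi x0).
    elim: n => [|n /andP[IH1 IH2]]; first by rewrite lexx /= (lt_trans bx0 (up _ bx0)).
    have u := up _ IH2; rewrite iterS; apply/andP; split.
      exact: le_trans IH1 (ltW u).
    exact: lt_trans IH2 u.
  exists (Num.min (x0 - z 1%N) (psi x0 - x0)).
    by rewrite lt_min !subr_gt0 -[in z 1%N < _]z0 zlt Hb.
  have h1 : Num.min (x0 - z 1%N) (psi x0 - x0) <= x0 - z 1%N.
    by rewrite ge_min lexx.
  have h2 : Num.min (x0 - z 1%N) (psi x0 - x0) <= psi x0 - x0.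
    by rewrite ge_min lexx orbT.
  have z1b := zb 1%N.
  move: (Num.min _ _) h1 h2 => e h1 h2 n; split.
    suff : x n.+1 <= z 1%N by lra.
    rewrite /x /= uphalf_half; case: (odd n) => //=.
    by apply: le_trans (ltW z1b); rewrite down.
  have -> : iter n.+1 phi x0 = if odd n then iter n./2.+1 psi x0
                               else phi (iter n./2 psi x0).
    rewrite -[in LHS](odd_double_half n); case: (odd n) => /=.
      by rewrite iter_double.
    by rewrite add0n iter_double.
  case: (odd n); first by left; have := psi_ge n./2; lra.
  by right; apply: le_trans (down _ (orb _)) _; lra.
have [e e0 He] := core; exists e; split => //.
- by move=> n; have [h _] := He n; rewrite x00 ler_normr; apply/orP; right; lra.
- move=> n; have [_ h] := He n; rewrite x00 ler_normr; apply/orP.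
  by case: h => h; [left|right]; lra.
split; last first.
  rewrite (_ : (fun k => _) = z) //; apply/funext => k.
  by rewrite /x odd_double doubleK.
by move=> k; rewrite x00 iter_double; apply: le_trans (ler_norm _); case: (growth k).
Qed.

End Dynamics.

Section Expanding.
Variable R : realType.
Implicit Types (phi : R -> R) (K : R).

Lemma has_isolated_orbit_opp phi :
  has_isolated_orbit (fun x => - phi (- x)) -> has_isolated_orbit phi.
Proof.
move=> [x [b [e [e0 xS far fwd [grow xb]]]]].
have it n y : iter n phi (- y) = - iter n (fun x => - phi (- x)) y.
  by elim: n => //= n ->; rewrite opprK.
exists (fun n => - x n), (- b), e; split=> //.
- by move=> n; rewrite -[in RHS](xS n) opprK.
- by move=> n; rewrite -opprD normrN.
- by move=> n; rewrite it -opprD normrN.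
- by split=> [k|]; [rewrite it normrN|exact: cvgN].
Qed.

Lemma expanding_sign phi K : continuous phi -> 0 < K ->
  (forall y, K <= y -> 2 * y <= `|phi y|) ->
  (forall y, K <= y -> 2 * y <= phi y) \/ (forall y, K <= y -> phi y <= - (2 * y)).
Proof.
move=> cphi K0 HK.
have [up|/existsNP[y]] := pselect (forall y, K <= y -> 2 * y <= phi y); first by left.
move=> /not_implyP[Ky /negP]; rewrite -ltNge => phiy; right => w Kw.
have phiy0 : phi y <= 0.
  by have := HK _ Ky; case: (ger0P (phi y)) => //; lra.
have := HK _ Kw; case: (ger0P (phi w)) => [phiw _|]; last by lra.
have [c mc c0] := continuous_zero cphi phiy0 phiw.
have Kc : K <= c by apply: le_trans mc; rewrite le_min Ky.
by have := HK _ Kc; rewrite c0 normr0; lra.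
Qed.

(** On each of the half-lines [y <= - K] and [K <= y], [phi] keeps a constant
    sign. Whatever the four combinations, [phi \o phi] tends to [+oo] at [+oo]
    or to [-oo] at [-oo], and conjugation by [- x] exchanges the two cases. *)
Lemma expanding_isolated_orbit phi K : continuous phi ->
  (exists a, phi a = a) -> 0 < K ->
  (forall y, K <= `|y| -> 2 * `|y| <= `|phi y|) -> has_isolated_orbit phi.
Proof.
move=> cphi [a fa] K0 HK.
have norm_ge y : K <= y -> `|y| = y by move=> Ky; rewrite ger0_norm //; lra.
have cN : continuous (fun x => phi (- x)).
  by move=> x; apply: continuous_comp; [exact: opp_continuous|exact: cphi].
have cR : continuous (fun x => - phi (- x)).
  by move=> x; apply: cvgN; exact: cN.
have up phi' : continuous phi' -> (exists a, phi' a = a) ->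
    (forall y, K <= y -> 2 * y <= phi' y) -> has_isolated_orbit phi'.
  move=> c' f' H; apply: (isolated_orbit_up c' f' K0) => y Ky.
  have h := H _ Ky; have Kp : K <= phi' y by lra.
  by have := H _ Kp; lra.
have fR : exists a, - phi (- a) = a by exists (- a); rewrite opprK fa.
have [right_up|right_down] : (forall y, K <= y -> 2 * y <= phi y) \/
    (forall y, K <= y -> phi y <= - (2 * y)).
  apply: (expanding_sign cphi K0) => y Ky; rewrite -[in 2 * y](norm_ge y) //.
  by apply: HK; rewrite norm_ge.
  by apply: up => //; exists a.
have [left_up|left_down] : (forall y, K <= y -> 2 * y <= phi (- y)) \/
    (forall y, K <= y -> phi (- y) <= - (2 * y)).
  apply: (expanding_sign cN K0) => y Ky; rewrite -[in 2 * y](norm_ge y) // -normrN.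
  by apply: HK; rewrite normrN norm_ge.
  apply: (isolated_orbit_up cphi _ K0); first by exists a.
  move=> y Ky; have h := right_down _ Ky.
  have Kp : K <= - phi y by lra.
  by have := left_up _ Kp; rewrite opprK; lra.
apply: has_isolated_orbit_opp; apply: up => // y Ky.
by have := left_down _ Ky; lra.
Qed.

Lemma poly_expanding (p : {poly R}) : (2 < size p)%N ->
  exists2 K : R, 0 < K & forall y, K <= `|y| -> 2 * `|y| <= `|p.[y]|.
Proof.
elim/poly_ind: p => [|p c _]; first by rewrite size_poly0.
rewrite size_MXaddC; case: ifP => // _; rewrite ltnS => sp.
have [C C0 HC] := poly_growth sp.
have cc := normr_ge0 c.
exists (4 * C + `|c| + 1); first by rewrite ltr_wpDl // addr_ge0 // mulr_ge0.
move=> y Ky; rewrite hornerD hornerM hornerX hornerC.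
have p3 : 3 <= `|p.[y]|.
  rewrite leNgt; apply/negP => p3.
  have : C * (1 + `|p.[y]|) <= C * 4 by rewrite ler_wpM2l //; lra.
  by have := HC y; lra.
have : 3 * `|y| <= `|p.[y] * y| by rewrite normrM ler_wpM2r.
by have := lerB_dist (p.[y] * y) (- c); rewrite normrN opprK; lra.
Qed.

Lemma poly_isolated_orbit (p : {poly R}) : (2 < size p)%N ->
  (exists a, p.[a] = a) -> has_isolated_orbit (horner p).
Proof.
move=> sp fp; have [K K0 HK] := poly_expanding sp.
by apply: (expanding_isolated_orbit _ fp K0) => //; exact: continuous_horner.
Qed.

End Expanding.

(** * The equation f o phi = l f + g in the Schwartz space *)

Section FunctionalEquation.
Variable R : realType.
Implicit Types (f g : schwartz R) (l : R[i]).

Lemma normcX (z : R[i]) n : normc (z ^+ n) = normc z ^+ n.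
Proof.
elim: n => [|n IH]; last by rewrite !exprS normcM IH.
by rewrite !expr0 /= expr0n addr0 expr1n sqrtr1.
Qed.

Lemma ler_exprn n (a c : R) : 0 <= a -> a <= c -> a ^+ n <= c ^+ n.
Proof. by move=> a0 ac; rewrite lerXn2r ?nnegrE // (le_trans a0). Qed.

Lemma ltr_exp2 (t : R) : exists n, t < 2 ^+ n.
Proof.
exists (Num.bound `|t|); apply: le_lt_trans (ler_norm t) _.
apply: lt_le_trans (archi_boundP (normr_ge0 t)) _.
by rewrite -natrX ler_nat ltnW // ltn_expl.
Qed.

(** Along [y], which grows at least geometrically, [f] decays faster than every
    geometric sequence, whereas [l ^+ (k.*2 + m) * f w] is itself geometric in
    [k]: this leaves only the zero sequence. *)
Lemma schwartz_fast_orbit f l (w : R) (y : nat -> R) m : l != 0 ->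
  (forall k, 2 ^+ k <= `|y k|) -> (forall k, f (y k) = l ^+ (k.*2 + m) * f w) ->
  f w = 0.
Proof.
move=> l0 grow E; apply/eq0_normc/eqP; pose N : R := normc (f w); rewrite -/N.
pose r : R := normc l.
have r0 : 0 < r by rewrite lt_def normc_ge0 andbT; apply: contra_neq l0 => /eq0_normc.
(* A power [j] of the decay of [f] that wins against the ratio [r ^+ 2]. *)
have [j Hj] := ltr_exp2 (2 / r ^+ 2).
rewrite ltr_pdivrMr ?exprn_gt0 // in Hj.
have [M HM] : exists M : R, forall x, `|x| ^+ j * normc (f x) <= M.
  have /(@asboolP (smooth f /\ rapidly_decreasing f))[_ /(_ j 0%N)[M H]] :=
    schwartz_funP f.
  exists M => x; apply: le_trans (H x); rewrite /cderive1n /=.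
  by case: (f x).
have N0 : 0 <= N := normc_ge0 _.
pose c : R := r ^+ m * N; have c0 : 0 <= c by rewrite mulr_ge0 // exprn_ge0 // ltW.
have bound k : 2 ^+ k * c <= M.
  apply: le_trans (HM (y k)); rewrite E normcM normcX -/r -/N exprD.
  rewrite -[r ^+ _ * _ * N]mulrA -/c [leRHS]mulrA ler_wpM2r // -mul2n exprM.
  apply: (@le_trans _ R ((2 ^+ j * r ^+ 2) ^+ k)).
    by have := ler_exprn k (ler0n R 2) (ltW Hj).
  rewrite exprMn ler_wpM2r ?exprn_ge0 ?(ltW r0) //.
  by rewrite -exprM mulnC exprM; apply: ler_exprn; rewrite ?exprn_ge0.
suff : c == 0 by rewrite mulf_eq0 expf_eq0 gt_eqF // andbF.
rewrite eq_le c0 andbT leNgt; apply/negP => cp.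
have [k] := ltr_exp2 (M / c); rewrite ltr_pdivrMr // => /(le_lt_trans (bound k)).
by rewrite ltxx.
Qed.

Lemma cvg_dist_ge (u : nat -> R) (a c d : R) : u @ \oo --> a ->
  (forall n, d <= `|u n - c|) -> d <= `|a - c|.
Proof.
move=> ua H; apply: (@closed_cvg _ R \oo _ (fun n => `|u n - c|)
  [set t | d <= t] (@closed_ge R d)).
- by near=> n; exact: H.
- by apply: cvg_norm; apply: cvgB => //; exact: cvg_cst.
Unshelve. all: by end_near. Qed.

Lemma schwartz_cvg_neq0 f (u : nat -> R) (a : R) (d : R) : u @ \oo --> a ->
  0 < d -> (forall n, d <= normc (f (u n))) -> f a != 0.
Proof.
move=> ua d0 H; have /schwartzP[s1 s2 _ _] := schwartz_funP f.
have c1 := rsmooth_continuous (n := 0%N) s1; have c2 := rsmooth_continuous (n := 0%N) s2.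
have lim : d <= `|complex.Re (f a)| + `|complex.Im (f a)|.
  apply: (@closed_cvg _ R \oo _ (fun n => `|complex.Re (f (u n))| +
      `|complex.Im (f (u n))|) [set t | d <= t] (@closed_ge R d)).
  - by near=> n; apply: le_trans (H n) (ler_normc_ReIm _).
  - apply: cvgD; apply: cvg_norm; first exact: (cvg_comp _ _ ua (c1 a)).
    exact: (cvg_comp _ _ ua (c2 a)).
by apply: contraTneq lim => -> /=; rewrite normr0 addr0 -ltNge.
Unshelve. all: by end_near. Qed.

(** Take for [g] a bump around [x 0]. Rapid decrease kills [f] at [phi.[x 0]],
    so that [f (x 0)] is not zero, and [normc l <= 1] propagates this lower
    bound along the backward orbit to its limit [b]. Thus [l] is an eigenvalue
    of the composition by [phi] on the cycle of [b], and then a second function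
    [h], not zero at [b] but zero at the other point of the cycle, is not in the
    range either. *)
Lemma isolated_orbit_not_surjective (phi : {poly R}) l : has_isolated_orbit (horner phi) ->
  l != 0 -> normc l <= 1 ->
  ~ forall g, exists f, forall x, f phi.[x] = l * f x + g x.
Proof.
move=> [x [b [e [e0 xS far fwd [grow xb]]]]] l0 l1 surj.
have [g [gx g0]] := schwartz_bump (x 0%N) e0; have [f E] := surj g.
have fw : f phi.[x 0%N] = 0.
  have it n : f (iter n (horner phi) phi.[x 0%N]) = l ^+ n * f phi.[x 0%N].
    elim: n => [|n IH]; first by rewrite mul1r.
    rewrite iterS E IH -iterSr g0 ?addr0; last exact: fwd.
    by rewrite exprS mulrA.
  apply: (@schwartz_fast_orbit f l _
    (fun k => iter k.+1.*2 (horner phi) (x 0%N)) 1 l0) => k.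
    by apply: le_trans (grow _); rewrite exprS ler_peMl // ?exprn_ge0 ?ler1n.
  by rewrite doubleS iterSr it addn1.
have fx0 : f (x 0%N) != 0.
  apply: contra_neq gx => fx0.
  by have := E (x 0%N); rewrite fw fx0 mulr0 add0r.
have fx n : normc (f (x 0%N)) <= normc (f (x n)).
  elim: n => // n IH; apply: le_trans IH _.
  rewrite -xS E g0 ?far // addr0 normcM.
  by rewrite ler_piMl ?normc_ge0.
have fb : f b != 0.
  apply: (schwartz_cvg_neq0 xb _ (fun k => fx k.*2)).
  by rewrite lt_def normc_ge0 andbT; apply: contra_neq fx0 => /eq0_normc.
have cphi : continuous (horner phi) by exact: continuous_horner.
have xb2 : (fun k => x k.+1.*2) @ \oo --> b.
  by rewrite (cvg_shiftS (fun k => x k.*2)).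
have xb1 : (fun k => x k.*2.+1) @ \oo --> phi.[b].
  have -> : (fun k => x k.*2.+1) = (fun k => phi.[x k.+1.*2]).
    by apply/funext => k; rewrite doubleS xS.
  exact: (cvg_comp _ _ xb2 (cphi b)).
(* [b] has period one or two under [phi]. *)
have bb : phi.[phi.[b]] = b.
  have c1 : (fun k => phi.[x k.*2.+1]) @ \oo --> phi.[phi.[b]].
    exact: (cvg_comp _ _ xb1 (cphi _)).
  have E1 : (fun k => phi.[x k.*2.+1]) = (fun k => x k.*2).
    by apply/funext => k; rewrite xS.
  rewrite E1 in c1.
  by rewrite -(cvg_lim (@Rhausdorff R) c1) (cvg_lim (@Rhausdorff R) xb).
have gb : g b = 0 by apply: g0; apply: cvg_dist_ge xb2 _ => k; exact: far.
have gpb : g phi.[b] = 0 by apply: g0; apply: cvg_dist_ge xb1 _ => k; exact: far.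
have Eb := E b; have Epb := E phi.[b].
rewrite gb addr0 in Eb; rewrite bb gpb addr0 in Epb.
(* The support of the second bump avoids [phi.[b]], unless [b] is fixed. *)
pose e' := if phi.[b] == b then 1 else `|phi.[b] - b|.
have e'0 : 0 < e'.
  by rewrite /e'; case: eqP => // /eqP h; rewrite normr_gt0 subr_eq0.
have [h [hb h0]] := schwartz_bump b e'0; have [f' E'] := surj h.
have F1 := E' b; have F2 := E' phi.[b]; rewrite bb in F2.
have ll : l * l = 1 by apply: (mulIf fb); rewrite mul1r -mulrA -Eb -Epb.
have [pb|pb] := eqVneq phi.[b] b.
  have l_1 : l = 1 by apply: (mulIf fb); rewrite mul1r -Eb pb.
  move: F1; rewrite pb l_1 mul1r => /eqP; rewrite addrC -subr_eq subrr => /eqP h'.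
  by rewrite -h' eqxx in hb.
have hpb : h phi.[b] = 0 by apply: h0; rewrite /e' (negbTE pb).
move: F2; rewrite hpb addr0 F1 mulrDr mulrA ll mul1r => /eqP.
rewrite addrC -subr_eq subrr eq_sym mulf_eq0 (negbTE l0) /= => /eqP h'.
by rewrite h' eqxx in hb.
Qed.

End FunctionalEquation.

(* size phi is the degree plus one *)
Theorem theorem2p8 (R : realType) (phi : {poly R}) (hphi : (2 < size phi)%N)
    (hfix : exists a : R, phi.[a] = a) :
  [set l : R[i] | `|l| <= 1] `\` [set 0] `<=` spectrum (comp_op (ltnW hphi)).
Proof.
move=> l [/= l1 l0] [S [_ _ ST]].
have io := poly_isolated_orbit hphi hfix.
have ln : normc l <= 1 by rewrite -lecR.
have {}l0 : l != 0 by apply/eqP.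
apply: (isolated_orbit_not_surjective io l0 ln) => g; exists (S g) => x.
have /(congr1 (fun f : schwartz R => f x)) /= := ST g.
by move=> <-; rewrite addrC subrK.
Qed.
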